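(* Let $p\in\mathbb{C}[z_1,z_2]$ be pure stable with $p(0,0)=0$, normalized so that its lowest order homogeneous term $P_M$ (of degree $M$) has non-negative real coefficients and the coefficient of $z_2^M$ in $P_M$ equals $1$. Let $A=\tfrac12(p+\bar p)$, $B=\tfrac1{2i}(p-\bar p)$ and $f=-B/A$. If $p$ has universal contact order at $(0,0)$ given by the even integer $K_{min}\ge2$, then $f$ is non-tangentially $C^{K_{min}-2}$ at $0$.
   Context: $\mathbb{H}$ is the open upper half plane and $\bar p(z)=\overline{p(\bar z_1,\bar z_2)}$. A polynomial $p\in\mathbb{C}[z_1,z_2]$ is pure stable if it has no zeros in $\mathbb{H}^2$ and no nonconstant factor in common with $\bar p$. It is known that a pure stable $p$ vanishing at $(0,0)$ factors near $(0,0)$ as $$p(z)=u(z)\prod_{j=1}^{k}\prod_{m=1}^{M_j}\left(z_2+q_j(z_1)+z_1^{2L_j}\psi_j(\mu_j^mz_1^{1/M_j})\right),$$ where $u$ is a convergent power series with $u(0,0)\neq 0$, for each $j$ the inner product over $m$ is an irreducible Weierstrass polynomial in $z_2$ of degree $M_j$, $L_j$ is a positive integer, $\mu_j=e^{2\pi i/M_j}$, $q_j\in\mathbb{R}[z_1]$, $q_j(0)=0$, $q_j'(0)>0$, $\deg q_j<2L_j$, and $\psi_j$ is analytic near $0$ with $\operatorname{Im}\psi_j(0)>0$ (the product over $m$ does not depend on the choice of $M_j$-th root of $z_1$). The universal contact order of $p$ at $(0,0)$ is $K_{min}=\min\{2L_1,\dots,2L_k\}$. For $c\ge1$ let $AR_c=\{z\in\mathbb{H}^2:1/c\le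 a/b\le c\text{ for all }a,b\in\{|z_1|,|z_2|,\operatorname{Im}z_1,\operatorname{Im}z_2\}\}$. $f$ is non-tangentially $C^n$ at $0$ if there is a polynomial $F\in\mathbb{C}[z_1,z_2]$ of degree at most $n$ such that, for every $c\ge1$, $f(z)=F(z)+o(|z_1|^n)$ as $z\to0$ with $z\in AR_c$. *)

(* Defs.v *)
From HB Require Import structures.
From mathcomp Require Import all_boot all_order all_algebra.
From mathcomp Require Import all_classical all_reals all_analysis.
(* The notations of mpoly clash with those of mathcomp-analysis. *)
From mathcomp Require Import -(notations) mpoly.
From mathcomp Require Import complex.

Set Implicit Arguments.
Unset Strict Implicit.
Unset Printing Implicit Defensive.

Import Order.TTheory GRing.Theory Num.Theory.
Import numFieldNormedType.Exports.

Local Open Scope classical_set_scope.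
Local Open Scope ring_scope.

(* The definitions are over an abstract numClosedFieldType C, for which the
   library has a topology, and are meant to be used with C := R[i].
   Inequalities in C use the partial order of mathcomp: x <= y holds iff y - x
   is a nonnegative real, so that, e.g., 0 < r forces r to be real. *)

Section PolynomialsAndGerms.
Variable C : numClosedFieldType.
Local Notation C2 := (C * C)%type.
Local Notation origin := ((0, 0) : C2).

Definition upper_half : set C := [set x | 0 < 'Im x].

Definition upper_half2 : set C2 := upper_half `*` upper_half.

Definition peval (p : mpoly 2 C) (z : C2) : C :=
  meval (fun i : 'I_2 => if i == ord0 then z.1 else z.2) p.

Definition pconj (p : mpoly 2 C) : mpoly 2 C :=
  map_mpoly (Num.conj : C -> C) p.

(* mmeasure mdeg g is the total degree of g plus one (and 0 for g = 0). *)
Definition pure_stable (p : mpoly 2 C) : Prop :=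
  (forall z, upper_half2 z -> peval p z != 0) /\
  (forall g : mpoly 2 C, (exists h, p = g * h) -> (exists h, pconj p = g * h) ->
     (mmeasure mdeg g <= 1)%N).

(* pihomog mdeg M p is the homogeneous part of degree M of p. *)
Definition lowest_form (p : mpoly 2 C) (M : nat) (P : mpoly 2 C) : Prop :=
  [/\ P = pihomog mdeg M p, P != 0 &
      forall d, (d < M)%N -> pihomog mdeg d p = 0].

Definition normalized (p : mpoly 2 C) : Prop :=
  exists (M : nat) (P : mpoly 2 C),
    [/\ lowest_form p M P,
        forall m : multinom 2, 0 <= mcoeff m P &
        mcoeff (mnm_muln (mnm1 ord_max) M) P = 1].

Definition partA (p : mpoly 2 C) : mpoly 2 C := 2^-1 *: (p + pconj p).

Definition partB (p : mpoly 2 C) : mpoly 2 C := (2 * 'i)^-1 *: (p - pconj p).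

Definition analytic1_at0 (g : C -> C) : Prop :=
  exists a : nat -> C,
    \forall t \near (0 : C), series (fun n => a n * t ^+ n) @ \oo --> g t.

(* The bound on the partial sums is the absolute convergence, at (r, r) and
   hence on the closed bidisc of radius r, of the double power series. *)
Definition analytic2_at0 (g : C2 -> C) : Prop :=
  exists (a : nat -> nat -> C) (r : C),
    [/\ 0 < r,
        exists B : C, forall n,
          \sum_(i < n) \sum_(j < n) `|a i j| * r ^+ (i + j) <= B &
        \forall z \near origin,
          (fun n => \sum_(i < n) \sum_(j < n) a i j * z.1 ^+ i * z.2 ^+ j)
            @ \oo --> g z].

(* Irreducible elements of the local ring of convergent power series, whose
   units are the series that do not vanish at the origin; the last clause
   also rules out the zero germ. *)
Definition irreducible_germ (w : C2 -> C) : Prop :=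
  [/\ analytic2_at0 w, w origin = 0 &
      forall g h : C2 -> C, analytic2_at0 g -> analytic2_at0 h ->
        (\forall z \near origin, w z = g z * h z) ->
        g origin != 0 \/ h origin != 0].

Definition weierstrass (M : nat) (w : C2 -> C) : Prop :=
  exists a : 'I_M -> C -> C,
    [/\ forall i, analytic1_at0 (a i), forall i, a i 0 = 0 &
        \forall z \near origin,
          w z = z.2 ^+ M + \sum_(i < M) a i z.1 * z.2 ^+ i].

End PolynomialsAndGerms.

Record branch (C : numClosedFieldType) := Branch {
  br_M : nat;
  br_L : nat;
  br_q : {poly C};
  br_psi : C -> C
}.

Section ContactOrder.
Variable C : numClosedFieldType.
Local Notation C2 := (C * C)%type.
Local Notation origin := ((0, 0) : C2).

(* mu M plays the role of exp (2 i pi / M), which an abstract C lacks. *)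
Variable mu : nat -> C.

(* M.-root z.1 is one particular M-th root of z.1. *)
Definition branch_prod (b : branch C) (z : C2) : C :=
  \prod_(1 <= m < (br_M b).+1)
    (z.2 + (br_q b).[z.1] +
     z.1 ^+ (2 * br_L b) *
       br_psi b (mu (br_M b) ^+ m * (br_M b).-root z.1)).

Definition admissible_branch (b : branch C) : Prop :=
  [/\ (0 < br_M b)%N /\ (0 < br_L b)%N,
      [/\ br_q b \is a polyOver Num.real, (br_q b).[0] = 0,
          0 < (br_q b)^`().[0] & ((size (br_q b)).-1 < 2 * br_L b)%N],
      analytic1_at0 (br_psi b) /\ 0 < 'Im (br_psi b 0) &
      weierstrass (br_M b) (branch_prod b) /\ irreducible_germ (branch_prod b)].

Definition branch_factorization (p : mpoly 2 C) (k : nat) (b : 'I_k -> branch C)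
    : Prop :=
  (forall j, admissible_branch (b j)) /\
  (exists u : C2 -> C, [/\ analytic2_at0 u, u origin != 0 &
     \forall z \near origin,
       peval p z = u z * \prod_(j < k) branch_prod (b j) z]).

(* K is the minimum of the 2 * L_j; the L_j are determined by p, so the choice
   of the factorization is immaterial. *)
Definition contact_order_wrt (p : mpoly 2 C) (K : nat) : Prop :=
  exists (k : nat) (b : 'I_k -> branch C),
    [/\ branch_factorization p b,
        exists j, K = (2 * br_L (b j))%N &
        forall j, (K <= 2 * br_L (b j))%N].

End ContactOrder.

Definition exp_2ipi_div (R : realType) (M : nat) : R[i] :=
  (cos (2 * pi / M%:R : R) +i* sin (2 * pi / M%:R : R))%C.

Definition universal_contact_order (R : realType) :
    mpoly 2 R[i] -> nat -> Prop :=
  contact_order_wrt (@exp_2ipi_div R).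

Section NonTangential.
Variable C : numClosedFieldType.
Local Notation C2 := (C * C)%type.
Local Notation origin := ((0, 0) : C2).

Definition AR (c : C) : set C2 :=
  upper_half2 (C := C) `&`
  [set z | let s := [:: `|z.1|; `|z.2|; 'Im z.1; 'Im z.2] in
     forall a b : C, a \in s -> b \in s -> c^-1 <= a / b <= c].

Definition nontangentially_C (n : nat) (f : C2 -> C) : Prop :=
  exists F : mpoly 2 C, (mmeasure mdeg F <= n.+1)%N /\
    forall c : C, 1 <= c ->
      (fun z => f z - peval F z) =o_ (within (AR c) (nbhs origin))
      (fun z : C2 => `|z.1| ^+ n).

End NonTangential.

(* Main.v *)
(* Every factor of the local factorization of p is z2 + q_j(z1) + O(|z|^(2 L_j))
   with q_j real. Hence, writing n = K_min - 1 and N for the number of factors,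
   p = U g + O(|z|^(n + N)), where U is a Taylor polynomial of the unit u and
   g = prod_j (z2 + q_j(z1))^(M_j) = O(|z|^N) is real. Therefore A and B agree
   with a g and b g up to O(|z|^(n + N)), for the polynomials
   a = (U + conj U) / 2 and b = (U - conj U) / 2i. Comparing p and U g on the
   axis z1 = 0, the normalization gives u(0, 0) = 1 = a(0, 0). Non-tangentially
   |g| is at least a multiple of |z|^N, because q_j'(0) > 0 makes the imaginary
   part of z2 + q_j'(0) z1 comparable to |z|. So B/A = b/a + O(|z|^n), and b/a
   has a Taylor polynomial of degree at most n - 1 = K_min - 2. *)
Require Import Defs.
From mathcomp Require Import all_boot all_order all_algebra.
From mathcomp Require Import all_classical all_reals all_analysis.
From mathcomp Require Import -(notations) mpoly.
From mathcomp Require Import complex ring.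

Set Implicit Arguments.
Unset Strict Implicit.

Import Order.TTheory GRing.Theory Num.Theory.
Import numFieldNormedType.Exports.
Local Open Scope classical_set_scope.
Local Open Scope ring_scope.

(** * Calculus of errors O(|z|^n) at the origin *)

Section Vanishing.
Variable C : numClosedFieldType.
Local Notation C2 := (C * C)%type.
Local Notation origin := ((0, 0) : C2).
Implicit Types (f g : C2 -> C) (z : C2) (n d : nat).

Definition norm1 z : C := `|z.1| + `|z.2|.

Lemma norm1_ge0 z : 0 <= norm1 z.
Proof. exact: addr_ge0. Qed.

Lemma norm1_fst z : `|z.1| <= norm1 z.
Proof. exact: ler_wpDr. Qed.

Lemma norm1_snd z : `|z.2| <= norm1 z.
Proof. exact: ler_wpDl. Qed.

Lemma near_originP (P : C2 -> Prop) :
  (\forall z \near origin, P z) <->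
  exists2 e : C, 0 < e & forall z, norm1 z < e -> P z.
Proof.
split.
  case/nbhs_ballP=> e /= e0 eP; exists e => // z ze; apply: eP.
  by split; rewrite /ball /= sub0r normrN;
    [apply: le_lt_trans (norm1_fst z) ze|apply: le_lt_trans (norm1_snd z) ze].
case=> e e0 eP; apply/nbhs_ballP; exists (e / 2) => /= [|z].
  exact: divr_gt0.
case; rewrite /ball /= !sub0r !normrN => z1 z2; apply: eP.
by rewrite (splitr e) ltrD.
Qed.

Lemma near_norm1_lt (e : C) : 0 < e -> \forall z \near origin, norm1 z < e.
Proof. by move=> e0; apply/near_originP; exists e. Qed.

Lemma near_originW (P : C2 -> Prop) :
  (forall z, P z) -> \forall z \near origin, P z.
Proof. by move=> allP; apply/near_originP; exists 1. Qed.

(** This is f = O(|z|^n) on a full neighbourhood of the origin in [C2], not only in [AR c], so that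
    the estimate can be reflected by [conj2], which leaves the upper half planes. *)
Definition vanishes n f :=
  exists2 B : C, 0 <= B & \forall z \near origin, `|f z| <= B * norm1 z ^+ n.

Lemma vanishes_near n f g :
  (\forall z \near origin, f z = g z) -> vanishes n f -> vanishes n g.
Proof.
move=> fg [B B0 fB]; exists B => //; near=> z.
have <- : f z = g z by near: z.
by near: z.
Unshelve. all: by end_near. Qed.

Lemma vanishes_ext n f g : f =1 g -> vanishes n f -> vanishes n g.
Proof. by move=> fg; apply: vanishes_near; apply: near_originW. Qed.

Lemma vanishes_cst (c : C) : vanishes 0 (fun=> c).
Proof. by exists `|c| => //; apply: near_originW => z; rewrite expr0 mulr1. Qed.

Lemma vanishes_fst : vanishes 1 (fun z => z.1).
Proof.
by exists 1 => //; apply: near_originW => z; rewrite mul1r norm1_fst.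
Qed.

Lemma vanishes_snd : vanishes 1 (fun z => z.2).
Proof.
by exists 1 => //; apply: near_originW => z; rewrite mul1r norm1_snd.
Qed.

Lemma vanishes0 n : vanishes n (fun=> 0).
Proof. by exists 0 => //; apply: near_originW => z; rewrite normr0 mul0r. Qed.

Lemma vanishesW m n f : (m <= n)%N -> vanishes n f -> vanishes m f.
Proof.
move=> mn [B B0 fB]; exists B => //; near=> z.
apply: le_trans (_ : B * norm1 z ^+ n <= _); first by near: z.
apply: ler_wpM2l => //; apply: ler_wiXn2l => //; first exact: norm1_ge0.
by apply: ltW; near: z; apply: near_norm1_lt.
Unshelve. all: by end_near. Qed.

Lemma vanishesD n f g :
  vanishes n f -> vanishes n g -> vanishes n (fun z => f z + g z).
Proof.
move=> [B B0 fB] [D D0 gD]; exists (B + D); first exact: addr_ge0.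
near=> z; apply: le_trans (ler_normD _ _) _; rewrite mulrDl.
by apply: lerD; near: z.
Unshelve. all: by end_near. Qed.

Lemma vanishesM m n f g :
  vanishes m f -> vanishes n g -> vanishes (m + n) (fun z => f z * g z).
Proof.
move=> [B B0 fB] [D D0 gD]; exists (B * D); first exact: mulr_ge0.
near=> z; rewrite normrM exprD mulrACA.
by apply: ler_pM => //; near: z.
Unshelve. all: by end_near. Qed.

Lemma vanishesZ n (c : C) f : vanishes n f -> vanishes n (fun z => c * f z).
Proof. by move=> fn; apply: (vanishesM (vanishes_cst c) fn). Qed.

Lemma vanishesN n f : vanishes n f -> vanishes n (fun z => - f z).
Proof.
by move/(vanishesZ (-1)); apply: vanishes_ext => z; rewrite mulN1r.
Qed.

Lemma vanishesB n f g :
  vanishes n f -> vanishes n g -> vanishes n (fun z => f z - g z).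
Proof. by move=> fn /vanishesN; apply: vanishesD. Qed.

Lemma vanishesX n k f : vanishes n f -> vanishes (k * n) (fun z => f z ^+ k).
Proof.
move=> fn; elim: k => [|k IHk]; first exact: vanishes_cst.
rewrite mulSn; apply: vanishes_ext (vanishesM fn IHk) => z.
by rewrite exprS.
Qed.

Lemma vanishes_sum (I : eqType) (r : seq I) (P : pred I) n (F : I -> C2 -> C) :
  (forall i, i \in r -> P i -> vanishes n (F i)) ->
  vanishes n (fun z => \sum_(i <- r | P i) F i z).
Proof.
elim: r => [|i r IHr] Fr.
  by apply: vanishes_ext (vanishes0 n) => z; rewrite big_nil.
have {}IHr := IHr (fun j jr => Fr j (mem_behead (s := i :: r) jr)).
have [Pi|nPi] := boolP (P i); last first.
  by apply: vanishes_ext IHr => z; rewrite big_cons (negPf nPi).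
apply: vanishes_ext (vanishesD (Fr i (mem_head _ _) Pi) IHr) => z.
by rewrite big_cons Pi.
Qed.

Definition conj2 z : C2 := (z.1^*, z.2^*).

Lemma norm1_conj2 z : norm1 (conj2 z) = norm1 z.
Proof. by rewrite /norm1 /= !norm_conjC. Qed.

Lemma near_conj2 (P : C2 -> Prop) :
  (\forall z \near origin, P z) -> \forall z \near origin, P (conj2 z).
Proof.
move/near_originP => [e e0 eP]; apply/near_originP; exists e => // z ze.
by apply: eP; rewrite norm1_conj2.
Qed.

(** Conjugating the arguments and the value preserves all moduli. This transfers estimates from p to
    [pconj p]. *)
Lemma vanishes_conj n f : vanishes n f -> vanishes n (fun z => (f (conj2 z))^*).
Proof.
move=> [B B0 /near_conj2 fB]; exists B => //.
by apply: filterS fB => z; rewrite norm_conjC norm1_conj2.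
Qed.

(* [g] is the leading part of [f], of order [d], up to a relative error of
   order [n]. *)
Definition agree n d f g :=
  vanishes d f /\ vanishes (n + d) (fun z => f z - g z).

Lemma agree_refl n d f : vanishes d f -> agree n d f f.
Proof.
by move=> fd; split=> //; apply: vanishes_ext (vanishes0 _) => z; rewrite subrr.
Qed.

Lemma agree_r n d f g : agree n d f g -> vanishes d g.
Proof.
move=> [fd fg]; have := vanishesB fd (vanishesW (leq_addl _ _) fg).
by apply: vanishes_ext => z; rewrite subKr.
Qed.

Lemma agree_near n d f f' g :
  (\forall z \near origin, f z = f' z) -> agree n d f g -> agree n d f' g.
Proof.
move=> ff' [fd fg]; split; first exact: vanishes_near fd.
by apply: vanishes_near fg; apply: filterS ff' => z ->.
Qed.

(** Write f f' - g g' = (f - g) f' + g (f' - g'); each summand has order n + d + d'. Relative errors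
    thus survive products, whatever the number of factors. *)
Lemma agreeM n d d' f g f' g' : agree n d f g -> agree n d' f' g' ->
  agree n (d + d') (fun z => f z * f' z) (fun z => g z * g' z).
Proof.
move=> fg fg'; have gd := agree_r fg.
case: fg fg' => [fd fg] [fd' fg']; split; first exact: vanishesM.
have h1 := vanishesM fg fd'; have h2 := vanishesM gd fg'.
rewrite addnCA in h2; rewrite -addnA in h1.
by apply: vanishes_ext (vanishesD h1 h2) => z; ring.
Qed.

Lemma agree_prod (I : Type) (r : seq I) n (d : I -> nat) (F G : I -> C2 -> C) :
  (forall i, agree n (d i) (F i) (G i)) ->
  agree n (\sum_(i <- r) d i) (fun z => \prod_(i <- r) F i z)
    (fun z => \prod_(i <- r) G i z).
Proof.
move=> FG; elim: r => [|i r IHr].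
  rewrite big_nil; have -> : (fun z => \prod_(i <- [::]) G i z) = (fun=> 1).
    by apply/funext => z; rewrite big_nil.
  have -> : (fun z => \prod_(i <- [::]) F i z) = (fun=> 1).
    by apply/funext => z; rewrite big_nil.
  exact/agree_refl/vanishes_cst.
rewrite big_cons; have := agreeM (FG i) IHr.
by congr agree; apply/funext => z; rewrite big_cons.
Qed.

End Vanishing.

(** * Orders of vanishing and Taylor truncation of polynomials *)

Section Poly.
Variable C : numClosedFieldType.
Local Notation C2 := (C * C)%type.
Local Notation origin := ((0, 0) : C2).
Implicit Types (p : mpoly 2 C) (z : C2).

Lemma pevalE p z :
  peval p z = \sum_(m <- msupp p) mcoeff m p * peval (mpolyX C m) z.
Proof.
by rewrite {1}/peval mevalE; apply: eq_bigr => m _; rewrite /peval mevalX.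
Qed.

Lemma peval_monomial (m : multinom 2) z :
  peval (mpolyX C m) z = z.1 ^+ m ord0 * z.2 ^+ m ord_max.
Proof.
rewrite /peval mevalX !big_ord_recl big_ord0 mulr1 /=.
by congr (_ * _ ^+ m _); apply: val_inj.
Qed.

Lemma vanishes_peval_monomial (m : multinom 2) :
  vanishes (mdeg m) (peval (mpolyX C m)).
Proof.
rewrite mdegE !big_ord_recl big_ord0 addn0.
have -> : lift ord0 ord0 = ord_max :> 'I_2 by apply: val_inj.
have := vanishesM (vanishesX (m ord0) (@vanishes_fst C))
  (vanishesX (m ord_max) (@vanishes_snd C)).
by rewrite !muln1; apply: vanishes_ext => z; rewrite peval_monomial.
Qed.

Lemma vanishes_peval n p :
  (forall m, m \in msupp p -> (n <= mdeg m)%N) -> vanishes n (peval p).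
Proof.
move=> np; have := vanishes_sum; move=> /(_ C _ (msupp p) xpredT n
  (fun m z => mcoeff m p * peval (mpolyX C m) z)) h.
apply: vanishes_ext (h _) => [z|m mp _]; first by rewrite pevalE.
apply/vanishesZ; exact: vanishesW (np m mp) (vanishes_peval_monomial m).
Qed.

Lemma vanishes0_peval p : vanishes 0 (peval p).
Proof. exact: vanishes_peval. Qed.

Lemma peval_pconj p z : peval (pconj p) z = (peval p (conj2 z))^*.
Proof.
elim/mpolyind: p => [|c m p _ _ IHp].
  by rewrite /pconj raddf0 /peval !meval0 rmorph0.
rewrite /pconj raddfD /= map_mpolyZ map_mpolyX /peval.
rewrite !mevalD !mevalZ -!/(peval _ _).
by rewrite IHp !peval_monomial rmorphD !rmorphM !rmorphXn /= !conjCK.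
Qed.

(** [F] collects the monomials of degree less than n. As [mmeasure mdeg] is the degree plus one, the
    bound n means degree at most n - 1. *)
Lemma peval_truncation n p : exists2 F : mpoly 2 C,
  (mmeasure mdeg F <= n)%N & vanishes n (fun z => peval p z - peval F z).
Proof.
pose F := \sum_(m <- msupp p | (mdeg m < n)%N) mcoeff m p *: mpolyX C m.
exists F.
  apply: leq_trans (mmeasure_sum _ _ _ _) _; apply/bigmax_leqP_seq => m _ mn.
  by apply: leq_trans (mmeasureZ_le _ _ _) _; rewrite mmeasureX.
have := vanishes_sum; move=> /(_ C _ (msupp p) (fun m => ~~ (mdeg m < n)%N) n
  (fun m z => mcoeff m p * peval (mpolyX C m) z)) h.
apply: vanishes_ext (h _) => [z|m mp].
  rewrite pevalE addrC.
  rewrite [in RHS](bigID (fun m : multinom 2 => (mdeg m < n)%N)) /=.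
  have -> : peval F z = \sum_(m <- msupp p | (mdeg m < n)%N)
      mcoeff m p * peval (mpolyX C m) z.
    by rewrite {1}/peval raddf_sum; apply: eq_bigr => m _; exact: mevalZ.
  by rewrite addKr.
rewrite -leqNgt => nm; apply/vanishesZ.
exact: vanishesW nm (vanishes_peval_monomial m).
Qed.

Lemma peval_origin p : peval p (0, 0) = mcoeff mnm0 p.
Proof.
elim/mpolyind: p => [|c m p _ _ IHp]; first by rewrite /peval meval0 mcoeff0.
rewrite /peval mevalD mevalZ -!/(peval _ _) IHp mcoeffD mcoeffZ mcoeffX.
rewrite peval_monomial /= -exprD expr0n; congr (_ * _%:R + _).
have -> : (m ord0 + m ord_max)%N = mdeg m.
  rewrite mdegE !big_ord_recl big_ord0 addn0; congr (_ + m _)%N.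
  exact: val_inj.
by rewrite mdeg_eq0.
Qed.

Lemma vanishes1_peval p : vanishes 1 (fun z => peval p z - peval p (0, 0)).
Proof.
pose q := p - mpolyC 2 (peval p (0, 0)).
have qE z : peval q z = peval p z - peval p (0, 0).
  by rewrite {1}/peval mevalB mevalC.
apply: (vanishes_ext qE); apply: vanishes_peval => m.
rewrite lt0n mdeg_eq0; apply: contraL => /eqP ->.
by rewrite mcoeff_msupp negbK -peval_origin qE subrr.
Qed.

(* The truncated geometric series in [1 - a] inverts [a] modulo [O(|z|^n)]. *)
Lemma peval_quotient n (a b : mpoly 2 C) : peval a (0, 0) = 1 ->
  exists2 F : mpoly 2 C, (mmeasure mdeg F <= n)%N &
    vanishes n (fun z => peval b z - peval F z * peval a z).
Proof.
move=> a0; pose e := 1 - a.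
have e1 : vanishes 1 (peval e).
  apply: vanishes_ext (vanishesN (vanishes1_peval a)) => z.
  by rewrite a0 opprB /peval mevalB meval1.
have [F Fn Fv] := peval_truncation n (b * \sum_(i < n) e ^+ i); exists F => //.
have h1 := vanishesM Fv (vanishes0_peval a).
have h2 := vanishesM (vanishesX n e1) (vanishes0_peval b).
rewrite addn0 in h1; rewrite muln1 addn0 in h2.
apply: vanishes_ext (vanishesD h1 h2) => z.
(* With e = 1 - a this identity says that a times the geometric sum is 1 - e^n; the defect b e^n is
   the term [h2]. *)
have := congr1 (fun q => peval q z) (subrX1 e n).
have -> : e - 1 = - a by rewrite /e addrAC subrr add0r.
rewrite /peval !(rmorphM, rmorphN, rmorphB, rmorphXn, rmorph1) /= => h.
move/eqP: h; rewrite subr_eq => /eqP ->; ring.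
Qed.

End Poly.

(** * Bounds for convergent power series in one and two variables *)

Section Analytic.
Variable C : numClosedFieldType.
Local Notation C2 := (C * C)%type.
Local Notation origin := ((0, 0) : C2).

Lemma norm_lim_le m (u : nat -> C) (l B : C) : 0 <= B ->
  u @ \oo --> l -> (forall n, (m <= n)%N -> `|u n| <= B) -> `|l| <= B.
Proof.
move=> B0 ul uB; rewrite real_leNgt ?ger0_real //; apply/negP => Bl.
have /cvgrPdist_lt/(_ _ (_ : 0 < `|l| - B)) := ul; rewrite subr_gt0 => /(_ Bl).
case=> N _ /(_ (maxn m N) (leq_maxr m N)) /=; rewrite ltrBrDr; apply/negP.
rewrite -real_leNgt ?realD ?ger0_real //.
rewrite -{1}(subrK (u (maxn m N)) l); apply: le_trans (ler_normD _ _) _.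
by apply: lerD => //; apply: uB; apply: leq_maxl.
Qed.

(** The terms of the series at r/2 tend to 0, hence are bounded; for |t| < r/4 this dominates the
    series by a geometric one of ratio 1/2. *)
Lemma series_bounded_near0 (psi : C -> C) : analytic1_at0 psi ->
  exists2 B : C, 0 <= B &
    exists2 e : C, 0 < e & forall t, `|t| < e -> `|psi t| <= B.
Proof.
case=> a /nbhs_ballP[r /= r0 conv].
have rh0 : 0 < r / 2 by rewrite divr_gt0.
have conv_half : cvg (series (fun n => a n * (r / 2) ^+ n) @ \oo).
  apply: cvgP; apply: (conv (r / 2)).
  rewrite /ball /= sub0r normrN gtr0_norm //.
  by rewrite ltr_pdivrMr // ltr_pMr // ltr1n.
have [D [Dreal Db]] := cvg_seq_bounded (cvgP _ (cvg_series_cvg_0 conv_half)).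
(* [Db] bounds the terms by every number strictly greater than [D], whence D + 1. *)
have {Db} aD n : `|a n| * (r / 2) ^+ n <= D + 1.
  rewrite -{1}(gtr0_norm rh0) -normrX -normrM; apply: Db => //.
  by rewrite ltrDl.
have D0 : 0 <= D + 1 by apply: le_trans (aD 0%N); rewrite expr0 mulr1.
exists ((D + 1) * 2); first by rewrite mulr_ge0.
exists (r / 4) => [|t tr]; first by rewrite divr_gt0.
have tr' : `|t| < r.
  apply: lt_trans tr _; rewrite ltr_pdivrMr // ltr_pMr // ltr1n //.
apply: (norm_lim_le (m := 0) _ (conv t _)); rewrite ?mulr_ge0 //.
  by rewrite /ball /= sub0r normrN.
move=> n _; rewrite /series /=; apply: le_trans (ler_norm_sum _ _ _) _.
apply: (@le_trans _ _ (\sum_(0 <= k < n) (D + 1) * 2^-1 ^+ k)).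
  apply: ler_sum => k _; rewrite normrM normrX.
  apply: le_trans (_ : `|a k| * ((r / 2) * 2^-1) ^+ k <= _).
    apply: ler_wpM2l => //; apply: lerXn2r; rewrite ?nnegrE //.
      by rewrite mulr_ge0 ?divr_ge0 // ltW.
    by rewrite -mulrA -invfM -natrM ltW.
  by rewrite exprMn mulrA ler_wpM2r ?exprn_ge0.
rewrite -mulr_sumr ler_wpM2l //.
have -> : \sum_(0 <= k < n) 2^-1 ^+ k = 2 - 2 * 2^-1 ^+ n :> C.
  elim: n => [|n IHn]; first by rewrite big_nil expr0 mulr1 subrr.
  by rewrite big_nat_recr //= IHn exprS; field.
by rewrite lerBlDr lerDl mulr_ge0 ?exprn_ge0.
Qed.

(** [U] is the square partial sum over i, j < n. Every other index pair has i + j >= n, so its term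
    gains a factor (|z|/r)^n over its bound at (r, r), and [B] controls the sum of these bounds. *)
Lemma analytic2_agree n (u : C2 -> C) : analytic2_at0 u ->
  exists U : mpoly 2 C, agree n 0 u (peval U).
Proof.
case=> a [r [r0 [B aB] conv]].
pose T (k : nat) (z : C2) :=
  \sum_(i < k) \sum_(j < k) a i j * z.1 ^+ i * z.2 ^+ j.
pose U : mpoly 2 C := \sum_(i < n) \sum_(j < n)
  a i j *: (mpolyX C (mnm1 ord0) ^+ i * mpolyX C (mnm1 ord_max) ^+ j).
have UE z : peval U z = T n z.
  rewrite /peval raddf_sum; apply: eq_bigr => i _.
  rewrite raddf_sum; apply: eq_bigr => j _ /=.
  by rewrite mevalZ rmorphM !rmorphXn /= !mevalXU /= mulrA.
have B0 : 0 <= B by apply: le_trans (aB 0%N); rewrite big_ord0.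
suff Uu : vanishes n (fun z => u z - peval U z).
  exists U; split; last by rewrite addn0.
  have := vanishesD (vanishesW (leq0n n) Uu) (vanishes0_peval U).
  by apply: vanishes_ext => z; rewrite subrK.
exists (B / r ^+ n); first by rewrite divr_ge0 ?exprn_ge0 // ltW.
near=> z.
have zr : norm1 z <= r by apply: ltW; near: z; apply: near_norm1_lt.
have convz : (fun k => T k z) @ \oo --> u z by near: z.
rewrite UE.
have le_term i j : (n <= i + j)%N -> 
  `|a i j * z.1 ^+ i * z.2 ^+ j| <=
    `|a i j| * r ^+ (i + j) * (norm1 z / r) ^+ n.
  move=> nij; rewrite !normrM !normrX -!mulrA ler_wpM2l //.
  apply: (@le_trans _ _ (norm1 z ^+ (i + j))).
    rewrite exprD; apply: ler_pM; rewrite ?exprn_ge0 //.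
      by apply: lerXn2r; rewrite ?nnegrE ?norm1_ge0 ?norm1_fst.
    by apply: lerXn2r; rewrite ?nnegrE ?norm1_ge0 ?norm1_snd.
  (* Split off n of the i + j factors: they give |z|^n on both sides, and the remaining ones are
     compared through |z| <= r. *)
  rewrite -(subnKC nij) !exprD expr_div_n [r ^+ n * _]mulrC -mulrA.
  rewrite [r ^+ n * _]mulrC divfK ?expf_neq0 ?gt_eqF // mulrC.
  apply: ler_wpM2r; first by rewrite exprn_ge0 ?norm1_ge0.
  by apply: lerXn2r; rewrite ?nnegrE ?norm1_ge0 // ltW.
have TnE k : (n <= k)%N -> T k z - T n z =
    \sum_(ij : 'I_k * 'I_k | ~~ ((ij.1 < n) && (ij.2 < n))%N)
      a ij.1 ij.2 * z.1 ^+ ij.1 * z.2 ^+ ij.2.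
  move=> nk; rewrite {1}/T pair_bigA /=.
  rewrite (bigID (fun ij : 'I_k * 'I_k => (ij.1 < n) && (ij.2 < n))%N) /=.
  rewrite addrC -[RHS]addr0 -addrA; congr (_ + _).
  apply/eqP; rewrite subr_eq0; apply/eqP.
  rewrite -(pair_big_dep (fun i : 'I_k => i < n)%N (fun (i j : 'I_k) => j < n)%N
    (fun i j : 'I_k => a i j * z.1 ^+ i * z.2 ^+ j)) /=.
  rewrite /T (big_ord_widen k (fun i : nat =>
    \sum_(j < n) a i j * z.1 ^+ i * z.2 ^+ j)) //.
  apply: eq_bigr => i _.
  by rewrite (big_ord_widen k (fun j : nat => a i j * z.1 ^+ i * z.2 ^+ j)).
have -> : B / r ^+ n * norm1 z ^+ n = B * (norm1 z / r) ^+ n.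
  by rewrite expr_div_n; ring.
have x0 : 0 <= (norm1 z / r) ^+ n.
  by rewrite exprn_ge0 // divr_ge0 ?norm1_ge0 // ltW.
(* u - U is the limit of T k - T n, so a bound uniform in k >= n suffices. *)
apply: (norm_lim_le (m := n) _ (cvgB convz (cvg_cst (T n z)))).
  exact: mulr_ge0.
move=> k nk /=; rewrite fctE TnE //; apply: le_trans (ler_norm_sum _ _ _) _.
apply: (@le_trans _ _ (\sum_(ij : 'I_k * 'I_k)
    `|a ij.1 ij.2| * r ^+ (ij.1 + ij.2) * (norm1 z / r) ^+ n)).
  rewrite [leRHS](bigID
    (fun ij : 'I_k * 'I_k => (ij.1 < n) && (ij.2 < n))%N) /=.
  apply: ler_wpDl.
    apply: sumr_ge0 => ij _; apply: mulr_ge0 => //; apply: mulr_ge0 => //.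
    by rewrite exprn_ge0 // ltW.
  apply: ler_sum => -[i j] /=; rewrite negb_and -!leqNgt => nij.
  apply: le_term; case/orP: nij => h; first exact: leq_trans h (leq_addr _ _).
  exact: leq_trans h (leq_addl _ _).
rewrite -mulr_suml ler_wpM2r //; apply: le_trans (aB k).
by rewrite (pair_bigA _ (fun i j : 'I_k => `|a i j| * r ^+ (i + j))).
Unshelve. all: by end_near. Qed.

End Analytic.

(** * Replacing each branch by its real polynomial part *)

Section Branches.
Variable C : numClosedFieldType.
Local Notation C2 := (C * C)%type.
Local Notation origin := ((0, 0) : C2).

Lemma vanishes0_horner (q : {poly C}) : vanishes 0 (fun z : C2 => q.[z.1]).
Proof.
elim/poly_ind: q => [|q c IHq].
  by apply: vanishes_ext (vanishes_cst (0 : C)) => z; rewrite horner0.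
have /(vanishesW (leq0n _)) := vanishesM IHq (@vanishes_fst C).
move/vanishesD/(_ (vanishes_cst c)); apply: vanishes_ext => z.
by rewrite hornerMXaddC.
Qed.

Lemma vanishes1_horner (q : {poly C}) :
  vanishes 1 (fun z : C2 => q.[z.1] - q.[0]).
Proof.
elim/poly_ind: q => [|q c _].
  by apply: vanishes_ext (vanishes0 C 1) => z; rewrite !horner0 subrr.
apply: vanishes_ext (vanishesM (vanishes0_horner q) (@vanishes_fst C)) => z.
by rewrite !hornerMXaddC mulr0 add0r addrK.
Qed.

(** For q X + c the derivative at 0 is q(0), so the remainder is z1 (q(z1) - q(0)) and
    [vanishes1_horner] applies. *)
Lemma vanishes2_horner (q : {poly C}) :
  vanishes 2 (fun z : C2 => q.[z.1] - q.[0] - q^`().[0] * z.1).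
Proof.
elim/poly_ind: q => [|q c _].
  by apply: vanishes_ext (vanishes0 C 2) => z; rewrite deriv0 !horner0; ring.
apply: vanishes_ext (vanishesM (vanishes1_horner q) (@vanishes_fst C)) => z.
rewrite derivMXaddC !hornerE; ring.
Qed.

Definition br_line (b : branch C) (z : C2) : C := z.2 + (br_q b).[z.1].

Lemma vanishes_br_line b : (br_q b).[0] = 0 -> vanishes 1 (br_line b).
Proof.
move=> q0; have := vanishesD (@vanishes_snd C) (vanishes1_horner (br_q b)).
apply: vanishes_ext => z.
by rewrite q0 subr0.
Qed.

(** After raising to the M-th power, only |[M.-root z.1]|^M = |z1| enters, so the discontinuity of
    the chosen root is harmless. The added 1 in the radius keeps the denominator positive when w =
    0. *)
Lemma near_mul_rootC (w e : C) M : (0 < M)%N -> 0 < e ->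
  \forall z \near origin, `|w * M.-root z.1| < e.
Proof.
move=> M0 e0; apply/near_originP.
have w0 : 0 < `|w| ^+ M + 1 by rewrite ltr_wpDl ?exprn_ge0.
exists (e ^+ M / (`|w| ^+ M + 1)) => [|z]; first by rewrite divr_gt0 ?exprn_gt0.
rewrite ltr_pdivlMr // => zlt.
rewrite -(ltr_pXn2r M0) ?nnegrE // ?ltW //.
rewrite -normrX exprMn rootCK // normrM normrX; apply: le_lt_trans zlt.
rewrite mulrC; apply: ler_pM => //; rewrite ?exprn_ge0 //.
  exact: norm1_fst.
by rewrite lerDl.
Qed.

(** Since psi is bounded near 0, the term z1^(2L) psi has order 2L >= n + 1. This is relative order
    n, because the line itself has order 1; then multiply over the M conjugate factors. *)
Lemma branch_agree (mu : nat -> C) n b : (n < 2 * br_L b)%N -> (0 < br_M b)%N ->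
  (br_q b).[0] = 0 -> analytic1_at0 (br_psi b) ->
  agree n (br_M b) (branch_prod mu b) (fun z => br_line b z ^+ br_M b).
Proof.
move=> nL M0 q0 /series_bounded_near0[B B0 [e e0 psiB]].
have line1 := vanishes_br_line q0.
have factor m : agree n 1 (fun z => z.2 + (br_q b).[z.1] +
    z.1 ^+ (2 * br_L b) * br_psi b (mu (br_M b) ^+ m * (br_M b).-root z.1))
    (br_line b).
  have err : vanishes (n + 1) (fun z : C2 => z.1 ^+ (2 * br_L b) *
      br_psi b (mu (br_M b) ^+ m * (br_M b).-root z.1)).
    have psi0 : vanishes 0 (fun z : C2 =>
        br_psi b (mu (br_M b) ^+ m * (br_M b).-root z.1)).
      exists B => //; near=> z; rewrite expr0 mulr1; apply: psiB.
      by near: z; apply: near_mul_rootC.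
    have := vanishesM (vanishesX (2 * br_L b) (@vanishes_fst C)) psi0.
    by apply: vanishesW; rewrite addn0 muln1 addn1.
  split.
    apply: vanishesD line1 _; apply: vanishesW err; exact: leq_addl.
  by apply: vanishes_ext err => z; rewrite /br_line addrAC subrr add0r.
have := agree_prod (index_iota 1 (br_M b).+1) factor.
rewrite sum_nat_const_nat muln1 subSS subn0; congr agree.
by apply/funext => z; rewrite prodr_const_nat subSS subn0.
Unshelve. all: by end_near. Qed.

End Branches.

(** * Lower bounds in the non-tangential regions *)

Section LowerBounds.
Variables (C : numClosedFieldType) (c : C).
Local Notation C2 := (C * C)%type.
Local Notation origin := ((0, 0) : C2).
Implicit Types (f g : C2 -> C).

(** The estimate is confined to [AR c], because the curves z2 + q(z1) = 0 pass through the origin; k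
    may depend on c. *)
Definition bounded_below d f := exists2 k : C, 0 < k &
  \forall z \near origin, AR c z -> k * norm1 z ^+ d <= `|f z|.

Lemma bounded_belowM d e f g : bounded_below d f -> bounded_below e g ->
  bounded_below (d + e) (fun z => f z * g z).
Proof.
move=> [k k0 fk] [l l0 gl]; exists (k * l); first exact: mulr_gt0.
apply: filterS2 fk gl => z fz gz zAR; rewrite normrM exprD mulrACA.
by apply: ler_pM; rewrite ?fz ?gz // mulr_ge0 ?exprn_ge0 ?norm1_ge0 // ltW.
Qed.

Lemma bounded_below1 : bounded_below 0 (fun=> 1).
Proof.
by exists 1 => //; apply: near_originW => z _; rewrite expr0 normr1 mulr1.
Qed.

Lemma bounded_belowX d k f :
  bounded_below d f -> bounded_below (k * d) (fun z => f z ^+ k).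
Proof.
move=> fd; elim: k => [|k IHk]; first exact: bounded_below1.
have -> : (fun z => f z ^+ k.+1) = (fun z => f z * f z ^+ k).
  by apply/funext => z; rewrite exprS.
by rewrite mulSn; apply: bounded_belowM.
Qed.

Lemma bounded_below_prod (I : Type) (r : seq I) (d : I -> nat)
    (F : I -> C2 -> C) :
  (forall i, bounded_below (d i) (F i)) ->
  bounded_below (\sum_(i <- r) d i) (fun z => \prod_(i <- r) F i z).
Proof.
move=> Fd; elim: r => [|i r IHr].
  have -> : (fun z => \prod_(i <- [::]) F i z) = (fun=> 1).
    by apply/funext => z; rewrite big_nil.
  by rewrite big_nil; apply: bounded_below1.
rewrite big_cons.
have -> : (fun z => \prod_(j <- i :: r) F j z) =
    (fun z => F i z * \prod_(j <- r) F j z).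
  by apply/funext => z; rewrite big_cons.
exact: bounded_belowM.
Qed.

Lemma bounded_below_perturb d f g : bounded_below d f ->
  vanishes d.+1 (fun z => g z - f z) -> bounded_below d g.
Proof.
move=> [k k0 fk] [B B0 gB]; exists (k / 2); first exact: divr_gt0.
have B1 : 0 < B + 1 by rewrite ltr_wpDl.
near=> z => zAR.
have fz : k * norm1 z ^+ d <= `|f z| by move: zAR; near: z.
have gz : `|g z - f z| <= B * norm1 z ^+ d.+1 by near: z.
(* At this size the perturbation is at most half of the lower bound, so the other half remains. *)
have zs : norm1 z < k / 2 / (B + 1).
  by near: z; apply: near_norm1_lt; rewrite !divr_gt0.
have : `|g z - f z| <= k / 2 * norm1 z ^+ d.
  apply: le_trans gz _; rewrite exprS mulrA.
  apply: ler_wpM2r; first by rewrite exprn_ge0 ?norm1_ge0.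
  rewrite ltr_pdivlMr // in zs; apply: le_trans (ltW zs); rewrite mulrC.
  by apply: ler_wpM2l; rewrite ?norm1_ge0 // lerDl.
move=> {}gz; have := ler_normD (f z - g z) (g z); rewrite subrK => fgz.
have {fgz} := le_trans fz fgz; rewrite distrC in gz.
rewrite [X in X * _](splitr k) mulrDl => h.
have := le_trans h (lerD gz (lexx _)).
by rewrite lerD2l.
Unshelve. all: by end_near. Qed.

Lemma Im_le_norm (x : C) : 'Im x <= `|x|.
Proof.
apply: le_trans (real_ler_norm (Creal_Im x)) _.
rewrite -(ler_pXn2r (n := 2)) ?nnegrE // (normC2_Re_Im x).
rewrite real_normK ?Creal_Im //.
by rewrite lerDr -realEsqr Creal_Re.
Qed.

Lemma AR_norm1_le z : AR c z -> norm1 z <= (c + c) * 'Im z.2.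
Proof.
move=> [[_ /= I2]] h; rewrite /norm1 mulrDl.
have le (a : C) :
    a \in [:: `|z.1|; `|z.2|; 'Im z.1; 'Im z.2] -> a <= c * 'Im z.2.
  move=> az; have /andP[_] : c^-1 <= a / 'Im z.2 <= c.
    by apply: h; rewrite ?az // !inE eqxx ?orbT.
  by rewrite ler_pdivrMr.
by apply: lerD; apply: le; rewrite !inE eqxx ?orbT.
Qed.

Lemma AR_norm1_le_fst z : AR c z -> norm1 z <= (1 + c) * `|z.1|.
Proof.
move=> [[/= I1 _]] h; rewrite /norm1 mulrDl mul1r lerD2l.
have z1 : 0 < `|z.1| by apply: lt_le_trans I1 (Im_le_norm _).
have /andP[_] : c^-1 <= `|z.2| / `|z.1| <= c.
  by apply: h; rewrite !inE eqxx ?orbT.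
by rewrite ler_pdivrMr.
Qed.

(** For s = q'(0) > 0 the modulus of z2 + s z1 is at least Im z2 + s Im z1 >= Im z2, which is at
    least |z|/(2c) in [AR c]. The rest of q has order 2 and is absorbed as a perturbation. *)
Lemma br_line_bounded_below (b : branch C) : 1 <= c ->
  (br_q b).[0] = 0 -> 0 < (br_q b)^`().[0] -> bounded_below 1 (br_line b).
Proof.
move=> c1 q0 q1; set s := _.[0] in q1.
have c0 : 0 < c by apply: lt_le_trans c1.
apply: (@bounded_below_perturb _ (fun z => z.2 + s * z.1)).
  exists (c + c)^-1; first by rewrite invr_gt0 addr_gt0.
  apply: near_originW => z zAR.
  rewrite expr1 mulrC ler_pdivrMr ?addr_gt0 // mulrC.
  apply: le_trans (AR_norm1_le zAR) _; apply: ler_wpM2l.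
    by rewrite addr_ge0 // ltW.
  apply: le_trans (Im_le_norm _); rewrite raddfD /= ImMl ?gtr0_real //.
  case: zAR => -[/= I1 _] _; by rewrite lerDl mulr_ge0 // ltW.
apply: vanishes_ext (vanishes2_horner (br_q b)) => z.
by rewrite q0 -/s /br_line; ring.
Qed.

End LowerBounds.

(** * Using the normalization on the axis z1 = 0 *)

Section Normalization.
Variable C : numClosedFieldType.
Local Notation C2 := (C * C)%type.
Local Notation origin := ((0, 0) : C2).
Implicit Types (p : mpoly 2 C) (f : C2 -> C).

Lemma mcoeff_pihomog_mdeg d p (m : multinom 2) :
  mcoeff m (pihomog mdeg d p) = if mdeg m == d then mcoeff m p else 0.
Proof.
elim/mpolyind: p => [|a k p _ _ IHp]; first by rewrite raddf0 mcoeff0 if_same.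
have -> : pihomog mdeg d (a *: mpolyX C k + p) =
    a *: pihomog mdeg d (mpolyX C k) + pihomog mdeg d p.
  exact: pihomog_is_linear.
rewrite !mcoeffD !mcoeffZ IHp pihomogX mcoeffX.
have [<-|km] := eqVneq k m.
  by case: ifP => _; rewrite ?mcoeffX ?mcoeff0 ?eqxx ?mulr0 ?addr0.
have -> : mcoeff m (if mdeg k == d then mpolyX C k else 0) = 0.
  by case: ifP => _; rewrite ?mcoeff0 // mcoeffX (negPf km).
by rewrite mulr0 !add0r.
Qed.

Lemma vanishes_on_axis d f : vanishes d f -> vanishes d (fun z => f (0, z.2)).
Proof.
move=> [B B0 /near_originP[e e0 fB]]; exists B => //.
apply/near_originP; exists e => // z ze.
have zz : norm1 (0, z.2) <= norm1 z by rewrite /norm1 /= normr0 add0r norm1_snd.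
apply: le_trans (fB _ (le_lt_trans zz ze)) _; apply: ler_wpM2l => //.
by apply: lerXn2r; rewrite ?nnegrE ?norm1_ge0.
Qed.

Lemma vanishes_monomial_eq0 (a : C) d :
  vanishes d.+1 (fun z => a * z.2 ^+ d) -> a = 0.
Proof.
move=> [B B0 /near_originP[e e0 aB]]; apply/eqP; rewrite -normr_eq0.
apply/negPn/negP => an0; have a0 : 0 < `|a| by rewrite lt_def an0 /=.
have B1 : 0 < B + 1 by rewrite ltr_wpDl.
(* This t is positive and strictly below both e and |a|/(B + 1): the point (0, t) lies in the
   neighbourhood, and B t < |a| contradicts the estimate there. *)
pose t := e * `|a| / (e * (B + 1) + `|a|).
have D0 : 0 < e * (B + 1) + `|a| by rewrite addr_gt0 // mulr_gt0.
have t0 : 0 < t by rewrite divr_gt0 // mulr_gt0.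
have tn : norm1 (0, t) = t by rewrite /norm1 /= normr0 add0r gtr0_norm.
have te : t < e.
  by rewrite ltr_pdivrMr // ltr_pM2l // ltrDr mulr_gt0.
have := aB (0, t); rewrite tn => /(_ te) /=.
rewrite normrM normrX (gtr0_norm t0) exprS mulrA.
suff Bt : B * t < `|a| by rewrite ler_pM2r ?exprn_gt0 // lt_geF.
rewrite /t mulrA ltr_pdivrMr // mulrA [ltRHS]mulrC ltr_pM2r //.
by rewrite mulrDr mulr1 -addrA mulrC ltrDl addr_gt0.
Qed.

(** Only pure powers of z2 survive on the axis; those of degree less than M are absent and z2^M has
    coefficient 1. *)
Lemma normalized_on_axis p : normalized p -> exists M,
  vanishes M.+1 (fun z => peval p (0, z.2) - z.2 ^+ M).
Proof.
case=> M [P [[-> P0 low] _ coefM]]; exists M.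
have mM : mdeg (mnm_muln (mnm1 (ord_max : 'I_2)) M) = M.
  by rewrite mdegMn mdeg1 mul1n.
rewrite mcoeff_pihomog_mdeg mM eqxx in coefM.
pose p' := p - mpolyX C (mnm_muln (mnm1 ord_max) M).
suff : vanishes M.+1 (fun z => peval p' (0, z.2)).
  apply: vanishes_ext => z.
  rewrite /peval mevalB -!/(peval _ _) peval_monomial /=.
  by rewrite !mulmnE !mnm1E /= mul0n mul1n mul1r.
have := @vanishes_sum C _ (msupp p') xpredT M.+1
  (fun m z => mcoeff m p' * peval (mpolyX C m) (0, z.2)).
move=> h; apply: vanishes_ext (h _) => [z|m mp _]; first by rewrite -pevalE.
apply: vanishesZ.
have [m0|m0] := eqVneq (m ord0) 0%N; last first.
  apply: vanishes_ext (vanishes0 C _) => z.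
  by rewrite peval_monomial /= expr0n (negPf m0) mul0r.
have mdegE2 : mdeg m = m ord_max.
  rewrite mdegE !big_ord_recl big_ord0 addn0 m0; congr (m _).
  exact: val_inj.
(* Exponent M is excluded because its coefficient cancels in [p'], smaller exponents because p has
   no part of degree less than M. *)
have Mm : (M < m ord_max)%N.
  rewrite ltn_neqAle; apply/andP; split.
    apply: contraL mp => /eqP mE; rewrite mcoeff_msupp negbK mcoeffB mcoeffX.
    suff -> : m = mnm_muln (mnm1 ord_max) M by rewrite eqxx coefM subrr.
    apply/mnmP => i; rewrite mulmnE mnm1E.
    case: (unliftP ord0 i) => [j ->|->] /=; last by rewrite m0 mul0n.
    have -> : lift ord0 j = ord_max by apply: val_inj; case: j => -[].
    by rewrite eqxx mul1n.
  rewrite leqNgt; apply/negP => mM'.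
  have := congr1 (mcoeff m) (low _ mM').
  rewrite mcoeff_pihomog_mdeg mdegE2 eqxx mcoeff0 => pm.
  move: mp; rewrite mcoeff_msupp mcoeffB pm mcoeffX.
  have -> : (mnm_muln (mnm1 ord_max) M == m) = false.
    by apply/eqP => mE; move: mM'; rewrite -mdegE2 -mE mM ltnn.
  by rewrite subr0 eqxx.
have := vanishesX (m ord_max) (@vanishes_snd C).
rewrite muln1 => /(vanishesW Mm).
by apply: vanishes_ext => z; rewrite peval_monomial /= m0 mul1r.
Qed.

(** On the axis p is z2^M to leading order by normalization, and u0 z2^N by the factorization, since
    g(0, z2) = z2^N. Comparing leading terms forces M = N and u0 = 1. *)
Lemma normalized_unit p (U : mpoly 2 C) (u0 : C) n k (b : 'I_k -> branch C) :
  normalized p -> u0 != 0 -> peval U (0, 0) = u0 ->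
  (forall j, (br_q (b j)).[0] = 0) ->
  let N := (\sum_(j < k) br_M (b j))%N in
  let g z := \prod_(j < k) br_line (b j) z ^+ br_M (b j) in
  (0 < n)%N -> vanishes (n + N) (fun z => peval p z - peval U z * g z) ->
  u0 = 1.
Proof.
move=> /normalized_on_axis[M pM] u0n U0 q0 N g n0 /(vanishesW _)-/(_ N.+1) pU.
have {}pU := vanishes_on_axis (pU (leq_add n0 (leqnn N))).
have gE z : g (0, z.2) = z.2 ^+ N.
  rewrite /g /N (eq_bigr (fun j => z.2 ^+ br_M (b j))) => [|j _].
    by rewrite prodrXr.
  by rewrite /br_line q0 addr0.
have UE := vanishes1_peval U; rewrite U0 in UE.
have {UE} := vanishesM (vanishes_on_axis UE) (vanishesX N (@vanishes_snd C)).
rewrite muln1 add1n => /(vanishesD pU) {}pU.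
have key : vanishes (minn M N).+1 (fun z => z.2 ^+ M - u0 * z.2 ^+ N).
  have h1 := vanishesW (_ : (minn M N).+1 <= M.+1)%N pM.
  have h2 := vanishesW (_ : (minn M N).+1 <= N.+1)%N pU.
  apply: vanishes_ext (vanishesB (h2 (geq_minr _ _)) (h1 (geq_minl _ _))) => z.
  by rewrite gE; ring.
have sndX d e (a : C) : (d <= e)%N -> vanishes d (fun z => a * z.2 ^+ e).
  move=> de; apply: vanishesZ; apply: vanishesW de _.
  by have := vanishesX e (@vanishes_snd C); rewrite muln1.
(* If M < N the term z2^M would have coefficient 0, giving 1 = 0; if N < M likewise u0 = 0. Equality
   leaves (1 - u0) z2^N of order N + 1. *)
case: (ltngtP M N) => [MN|NM|MN].
- move: key; rewrite (minn_idPl (ltnW MN)) => /vanishesD/(_ (sndX _ _ u0 MN)) h.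
  have /eqP : 1 = 0 :> C.
    by apply: (@vanishes_monomial_eq0 _ M); apply: vanishes_ext h => z; ring.
  by rewrite oner_eq0.
- move: key; rewrite (minn_idPr (ltnW NM)) => /vanishesB/(_ (sndX _ _ 1 NM)) h.
  have /eqP : - u0 = 0 :> C.
    by apply: (@vanishes_monomial_eq0 _ N); apply: vanishes_ext h => z; ring.
  by rewrite oppr_eq0 (negPf u0n).
move: key; rewrite MN minnn => h; apply/eqP.
rewrite eq_sym -subr_eq0; apply/eqP.
by apply: (@vanishes_monomial_eq0 _ N); apply: vanishes_ext h => z; ring.
Qed.

End Normalization.

(** * Real and imaginary parts, and the Taylor polynomial of the quotient *)

Section Main.
Variable C : numClosedFieldType.
Local Notation C2 := (C * C)%type.
Local Notation origin := ((0, 0) : C2).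
Implicit Types (p : mpoly 2 C) (f g : C2 -> C).

Lemma br_line_conj (b : branch C) z : br_q b \is a polyOver Num.real ->
  (br_line b (conj2 z))^* = br_line b z.
Proof.
move=> qR; rewrite /br_line rmorphD /= conjCK -horner_map /= conjCK.
congr (_ + _.[_]); apply/polyP => i; rewrite coef_map /=.
exact/CrealP/(polyOverP qR).
Qed.

(** As g is fixed by reflection, reflecting p - U g gives [pconj p] - [pconj U] g with the same
    order; take half the sum, and the difference over 2i. *)
Lemma vanishes_parts n p U g :
  (forall z, (g (conj2 z))^* = g z) ->
  vanishes n (fun z => peval p z - peval U z * g z) ->
  vanishes n (fun z => peval (partA p) z - peval (partA U) z * g z) /\
  vanishes n (fun z => peval (partB p) z - peval (partB U) z * g z).
Proof.
move=> gR pU; have := vanishes_conj pU => pUc.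
have pconjE z : (peval p (conj2 z) - peval U (conj2 z) * g (conj2 z))^* =
    peval (pconj p) z - peval (pconj U) z * g z.
  by rewrite rmorphB rmorphM /= gR !peval_pconj.
have {}pUc := vanishes_ext pconjE pUc; split.
  apply: vanishes_ext (vanishesZ 2^-1 (vanishesD pU pUc)) => z.
  by rewrite /partA /peval !mevalZ !mevalD; ring.
apply: vanishes_ext (vanishesZ (2 * 'i)^-1 (vanishesB pU pUc)) => z.
by rewrite /partB /peval !mevalZ !mevalB; ring.
Qed.

(** With F approximating b/a, write B - F A = (B - b g) + (b - F a) g - F (A - a g), of order n + 1
    + N. Dividing by A, which is at least a multiple of |z|^N in [AR c], leaves O(|z|^(n+1)), hence
    o(|z1|^n). *)
Lemma nontangentially_C_quotient n N A B a b g :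
  peval a (0, 0) = 1 -> vanishes N g ->
  (forall c, 1 <= c -> bounded_below c N g) ->
  vanishes (n.+1 + N) (fun z => peval A z - peval a z * g z) ->
  vanishes (n.+1 + N) (fun z => peval B z - peval b z * g z) ->
  nontangentially_C n (fun z : C2 => - (peval B z / peval A z)).
Proof.
move=> a0 gN glow Aag Bbg.
have [F Fn Fv] := peval_quotient n.+1 b a0.
have pN z : peval (- F) z = - peval F z by rewrite /peval mevalN.
exists (- F); split; first by rewrite mmeasureN.
move=> c c1; apply/eqoP => e e0.
(* A - g = (A - a g) + (a - 1) g has order N + 1 because a(0, 0) = 1, so A inherits the lower bound
   of g. *)
have Alow : bounded_below c N (peval A).
  apply: bounded_below_perturb (glow c c1) _.
  have a1 := vanishes1_peval a; rewrite a0 in a1.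
  apply: vanishes_ext (vanishesD (vanishesW _ Aag) (vanishesM a1 gN)) => [z|].
    by ring.
  by rewrite -add1n leq_add2r.
have num : vanishes (n.+1 + N) (fun z => peval B z - peval F z * peval A z).
  have h1 := vanishesM Fv gN; have h2 := vanishesM (vanishes0_peval F) Aag.
  by apply: vanishes_ext (vanishesB (vanishesD Bbg h1) h2) => z; ring.
case: Alow num => k k0 Ak [D D0 numD].
have c0 : 0 < 1 + c by rewrite addr_gt0 // (lt_le_trans _ c1).
(* In [AR c] one has |z| <= (1 + c)|z1|, so the error is at most this constant times |z1|^(n+1);
   taking |z| below e over the constant makes it at most e |z1|^n. *)
have D1 : 0 < (D + 1) / k * (1 + c) ^+ n.+1.
  by rewrite mulr_gt0 ?exprn_gt0 // divr_gt0 // ltr_wpDl.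
have small := near_norm1_lt (divr_gt0 e0 D1).
have : \forall z \near origin, AR c z -> 
    `|- (peval B z / peval A z) - peval (- F) z| <= e * `| `|z.1| ^+ n|.
  apply: filterS3 Ak numD small => z Az numz zs zAR; have {}Az := Az zAR.
  have s0 : 0 < norm1 z.
    case: zAR => -[/= I1 _] _.
    by apply: lt_le_trans (norm1_fst z); apply: lt_le_trans I1 (Im_le_norm _).
  have A0 : 0 < `|peval A z|.
    by apply: lt_le_trans Az; rewrite mulr_gt0 ?exprn_gt0.
  have An0 : peval A z != 0 by rewrite -normr_gt0.
  have -> : - (peval B z / peval A z) - peval (- F) z =
      - ((peval B z - peval F z * peval A z) / peval A z).
    by rewrite pN; field.
  rewrite normrN normrM normfV ler_pdivrMr // normrX normr_id.
  apply: le_trans numz _.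
  apply: (@le_trans _ _ (e * `|z.1| ^+ n * (k * norm1 z ^+ N))); last first.
    by apply: ler_wpM2l => //; rewrite mulr_ge0 ?exprn_ge0 // ltW.
  rewrite exprD !mulrA; apply: ler_wpM2r; first by rewrite exprn_ge0 ?norm1_ge0.
  apply: (@le_trans _ _ ((D + 1) * (1 + c) ^+ n.+1 * `|z.1| ^+ n.+1)).
    rewrite -mulrA -exprMn; apply: ler_pM; rewrite ?exprn_ge0 ?norm1_ge0 //.
      by rewrite lerDl.
    apply: lerXn2r; rewrite ?nnegrE ?norm1_ge0 ?mulr_ge0 // ?(ltW c0) //.
    exact: AR_norm1_le_fst.
  rewrite [`|z.1| ^+ n.+1]exprSr mulrA [leRHS]mulrAC [leLHS]mulrAC.
  apply: ler_wpM2r; first by rewrite exprn_ge0.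
  apply: (@le_trans _ _ ((D + 1) * (1 + c) ^+ n.+1 * norm1 z)).
    apply: ler_wpM2l; last exact: norm1_fst.
    by apply: mulr_ge0; [exact: addr_ge0|exact/exprn_ge0/ltW].
  rewrite -ler_pdivrMr //; apply: ltW; rewrite ltr_pdivlMr // in zs.
  apply: le_lt_trans zs; rewrite le_eqVlt; apply/orP; left; apply/eqP.
  by field; rewrite gt_eqF.
by [].
Qed.

End Main.

(** The relative precision is K - 1, since K - 1 < 2 L_j for every j; an error O(|z|^(K-1)) is
    o(|z1|^(K-2)) non-tangentially, which accounts for the exponent K - 2. *)
Lemma nontangentially_C_of_contact_order (C : numClosedFieldType)
    (mu : nat -> C) (p : mpoly 2 C) (K : nat) :
  normalized p -> (2 <= K)%N -> contact_order_wrt mu p K ->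
  nontangentially_C (K - 2) (fun z => - (peval (partB p) z / peval (partA p) z)).
Proof.
move=> p_norm K2 [k [b [[adm [u [u_an u0 pu]]] _ KL]]].
pose N := (\sum_(j < k) br_M (b j))%N.
pose g z := \prod_(j < k) br_line (b j) z ^+ br_M (b j).
have q0 j : (br_q (b j)).[0] = 0 by case: (adm j) => _ [].
have [U uU] := analytic2_agree K.-1 u_an.
have branchU j : agree K.-1 (br_M (b j)) (branch_prod mu (b j))
    (fun z => br_line (b j) z ^+ br_M (b j)).
  case: (adm j) => -[M0 _] _ [psi_an _] _; apply: branch_agree => //.
  by apply: leq_trans (KL j); rewrite prednK // (leq_trans _ K2).
have pU := agree_near (_ : \forall z \near _, _ = peval p z)
  (agreeM uU (agree_prod (index_enum 'I_k) branchU)).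
have {}pU := pU (filterS (fun z h => esym h) pu).
have gN : vanishes N g := agree_r (agree_prod (index_enum 'I_k) branchU).
case: pU => _; rewrite add0n -/N => pU.
have n0 : (0 < K.-1)%N by rewrite -subn1 subn_gt0.
(* At the origin the bound on |u - U| is a multiple of 0^(K-1), which is 0 because K - 1 > 0. *)
have U0 : peval U (0, 0) = u (0, 0).
  case: uU => _ [B _ /near_originP[e e0 /(_ (0, 0))]].
  rewrite /norm1 /= normr0 addr0 => /(_ e0).
  by rewrite addn0 expr0n gtn_eqF // mulr0 normr_le0 subr_eq0 => /eqP.
have u1 := normalized_unit p_norm u0 U0 q0 n0 pU.
have gR z : (g (conj2 z))^* = g z.
  rewrite /g rmorph_prod; apply: eq_bigr => j _.
  rewrite rmorphXn /= br_line_conj //.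
  by case: (adm j) => _ [].
have [pA pB] := vanishes_parts gR pU.
have KE : (K - 2).+1 = K.-1 by rewrite -subn1 -subSn.
rewrite -KE in pA pB.
apply: nontangentially_C_quotient pA pB => // [|c c1].
  (* The constant term of [partA U] is half the sum of U(0, 0) = 1 and its conjugate, that is 1. *)
  rewrite /partA /peval mevalZ mevalD -!/(peval _ _) peval_pconj.
  rewrite /conj2 /= !conjC0 U0 u1 conjC1.
  by field.
have lb j : bounded_below c (br_M (b j))
    (fun z => br_line (b j) z ^+ br_M (b j)).
  have q1 : 0 < (br_q (b j))^`().[0] by case: (adm j) => _ [].
  have := bounded_belowX (br_M (b j)) (br_line_bounded_below c1 (q0 j) q1).
  by rewrite muln1.
exact: bounded_below_prod lb.
Qed.

Unset Implicit Arguments.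

Theorem theorem3p11 (R : realType) (p : mpoly 2 R[i]) (K : nat)
  (p_stable : pure_stable p) (p0 : peval p (0, 0) = 0)
  (p_normalized : normalized p)
  (K_even : ~~ odd K) (K_ge2 : (2 <= K)%N)
  (p_K : universal_contact_order p K) :
  nontangentially_C (K - 2) (fun z => - (peval (partB p) z / peval (partA p) z)).
Proof. exact: nontangentially_C_of_contact_order p_K. Qed.
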